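(* Let $C$ and $D$ be two non-empty closed $\mathbb{B}$-convex subsets of $\mathbb{R}^n$ with $C\cap D=\emptyset$. Then there exist an idempotent symmetric form $f:\mathbb{R}^n\to\mathbb{R}$, $f(x)=\langle a,x\rangle_\infty=\boxplus_{i\in[n]}a_ix_i$ with $a\in\mathbb{R}^n\setminus\{0\}$, and a real number $c$ such that $$C\subset[f^-\le c]\quad\text{and}\quad D\subset[f^+\ge c],$$ where $f^-$ and $f^+$ are respectively the lower and the upper semi-continuous regularizations of $f$.
   Context: Notation: $\mathbb{N}=\{0,1,2,\dots\}$ and $[n]=\{1,\dots,n\}$. For $p\in\mathbb{N}$ let $\varphi_p(\lambda)=\lambda^{2p+1}$, a bijection of $\mathbb{R}$, and let $\phi_p:\mathbb{R}^n\to\mathbb{R}^n$ be its componentwise version. For a finite set $A\subset\mathbb{R}^n$, $Co^p(A)=\phi_p^{-1}\big(Co(\phi_p(A))\big)$, where $Co$ is the usual convex hull. For a sequence of sets $A^{(p)}\subset\mathbb{R}^n$, $\mathrm{Ls}_{p\to\infty}A^{(p)}$ is the set of limits of convergent sequences $x^{(p_k)}\in A^{(p_k)}$ along subsequences $(p_k)$. Define $Co^\infty(A)=\mathrm{Ls}_{p\to\infty}Co^p(A)$. A set $C\subset\mathbb{R}^n$ is $\mathbb{B}$-convex when $Co^\infty(A)\subset C$ for every finite subset $A$ of $C$. For a finite family of reals, $\boxplus_{i\in I}u_i=\lim_{p\to\infty}\big(\sum_{i\in I}u_i^{2p+1}\big)^{1/(2p+1)}$. Explicitly, for $\alpha>0$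 put $\xi(\alpha)=\mathrm{Card}\{i:u_i=\alpha\}-\mathrm{Card}\{i:u_i=-\alpha\}$; the value is $0$ if $\xi\equiv0$, and otherwise it is $\alpha^*$ or $-\alpha^*$ according to whether $\xi(\alpha^* )>0$ or $<0$, where $\alpha^*$ is the largest $\alpha>0$ with $\xi(\alpha)\ne0$. The lower (upper) semi-continuous regularization of $f$ is its largest lower semi-continuous minorant (smallest upper semi-continuous majorant). For $f=\langle a,\cdot\rangle_\infty$ it is known that $f^-(x)=\langle a,x\rangle_\infty^-=a_1x_1\stackrel{-}{\smile}\cdots\stackrel{-}{\smile}a_nx_n$ and $f^+(x)=\langle a,x\rangle_\infty^+=-\langle a,-x\rangle_\infty^-$, where $u\stackrel{-}{\smile}v$ equals $u$ if $|u|>|v|$, $\min\{u,v\}$ if $|u|=|v|$, and $v$ if $|u|<|v|$ (this operation is associative). For $g:\mathbb{R}^n\to\mathbb{R}$, $[g\le c]=\{x:g(x)\le c\}$ and $[g\ge c]=\{x:g(x)\ge c\}$. *)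

(* Defs.v *)
From HB Require Import structures.
From mathcomp Require Import all_boot all_order all_algebra.
From mathcomp Require Import all_classical all_reals all_analysis.

Set Implicit Arguments.
Unset Strict Implicit.
Unset Printing Implicit Defensive.

Import Order.TTheory GRing.Theory Num.Theory.
Import numFieldNormedType.Exports.

Local Open Scope classical_set_scope.
Local Open Scope ring_scope.

Section PowerMaps.
Context {R : realType}.
Implicit Types (p : nat) (t : R).

Definition varphi p t : R := t ^+ (2 * p).+1.

(* [powR] is only meaningful for a nonnegative base, hence the sign. *)
Definition varphi_inv p t : R := Num.sg t * `|t| `^ ((2 * p).+1%:R^-1).

Lemma varphiN p t : varphi p (- t) = - varphi p t.
Proof. by rewrite /varphi exprNn -signr_odd /= oddM /= mulN1r. Qed.

Lemma varphi_invN p t : varphi_inv p (- t) = - varphi_inv p t.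
Proof. by rewrite /varphi_inv sgrN normrN mulNr. Qed.

Lemma varphiK p : cancel (varphi p) (varphi_inv p).
Proof.
have pos t : 0 <= t -> varphi_inv p (varphi p t) = t.
  move=> t0; rewrite /varphi_inv /varphi ger0_norm ?exprn_ge0//.
  have [->|tN0] := eqVneq t 0; first by rewrite expr0n/= sgr0 mul0r.
  rewrite gtr0_sg ?exprn_gt0 ?lt_neqAle 1?eq_sym ?tN0// mul1r.
  by rewrite -powR_mulrn// -powRrM divff ?pnatr_eq0// powRr1.
move=> t; have [/pos//|t0] := leP 0 t.
by rewrite -[t]opprK varphiN varphi_invN pos// oppr_ge0 ltW.
Qed.

Lemma varphi_invK p : cancel (varphi_inv p) (varphi p).
Proof.
have pos t : 0 <= t -> varphi p (varphi_inv p t) = t.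
  move=> t0; rewrite /varphi_inv /varphi ger0_norm//.
  have [->|tN0] := eqVneq t 0; first by rewrite sgr0 mul0r expr0n.
  rewrite gtr0_sg ?lt_neqAle 1?eq_sym ?tN0// mul1r.
  by rewrite -powR_mulrn ?powR_ge0// -powRrM mulVf ?pnatr_eq0// powRr1.
move=> t; have [/pos//|t0] := leP 0 t.
by rewrite -[t]opprK varphi_invN varphiN pos// oppr_ge0 ltW.
Qed.

End PowerMaps.

Section BConvexity.
Context {R : realType} {n : nat}.
Implicit Types (p : nat) (A C : set 'rV[R]_n).

Definition phi p (x : 'rV[R]_n) : 'rV[R]_n := map_mx (varphi p) x.

Definition convex_hull A : set 'rV[R]_n :=
  smallest (@convex_set R 'rV[R]_n) A.

Definition Co p A : set 'rV[R]_n := phi p @^-1` convex_hull (phi p @` A).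

(* Kuratowski upper limit: limits along strictly increasing subsequences. *)
Definition Ls (A_ : nat -> set 'rV[R]_n) : set 'rV[R]_n :=
  [set x | exists (k : nat -> nat) (y : nat -> 'rV[R]_n),
    [/\ increasing_seq k, (forall j, A_ (k j) (y j)) & y @ \oo --> x]].

Definition Co_infty A : set 'rV[R]_n := Ls (fun p => Co p A).

Definition Bconvex C : Prop :=
  forall A, finite_set A -> A `<=` C -> Co_infty A `<=` C.

End BConvexity.

Section IdempotentForm.
Context {R : realType}.

(* The limit exists for every finite family, so [lim] takes no default value:
   terms with opposite values cancel for every p, and the surviving terms of
   largest absolute value all have the same sign and determine the limit. *)
Definition boxplus (I : finType) (u : I -> R) : R :=
  lim ((fun p : nat => varphi_inv p (\sum_(i : I) varphi p (u i))) @ \oo).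

Definition idempotent_form n (a x : 'rV[R]_n) : R :=
  boxplus (fun i : 'I_n => a 0 i * x 0 i).

End IdempotentForm.

(* Extended real values make the pointwise supremum (infimum) total, so that
   the regularizations exist for every function. *)
Section Regularization.
Context {X : topologicalType} {R : realType}.
Implicit Types f g : X -> \bar R.
Local Open Scope ereal_scope.

Definition upper_semicontinuous f := forall x a, f x < a%:E ->
  exists2 V, nbhs x V & forall y, V y -> f y < a%:E.

Definition lsc_regularization f : X -> \bar R := fun x =>
  ereal_sup [set g x | g in
    [set g | lower_semicontinuous g /\ forall y, g y <= f y]].

Definition usc_regularization f : X -> \bar R := fun x =>
  ereal_inf [set g x | g in
    [set g | upper_semicontinuous g /\ forall y, f y <= g y]].

Lemma lsc_regularizationP f :
  [/\ lower_semicontinuous (lsc_regularization f),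
      forall x, lsc_regularization f x <= f x &
      forall g, lower_semicontinuous g -> (forall x, g x <= f x) ->
        forall x, g x <= lsc_regularization f x].
Proof.
have ub g : lower_semicontinuous g -> (forall x, g x <= f x) ->
    forall x, g x <= lsc_regularization f x.
  by move=> lg gf x; apply: ereal_sup_ubound; exists g.
split=> // [x a|x].
  move=> /ereal_sup_gt[_ [g [lg gf] <-] /lg[V xV Va]]; exists V => // y /Va.
  by move=> /lt_le_trans; apply; exact: ub.
by apply: ge_ereal_sup => _ [g [_ gf] <-].
Qed.

Lemma usc_regularizationP f :
  [/\ upper_semicontinuous (usc_regularization f),
      forall x, f x <= usc_regularization f x &
      forall g, upper_semicontinuous g -> (forall x, f x <= g x) ->
        forall x, usc_regularization f x <= g x].
Proof.
have lb g : upper_semicontinuous g -> (forall x, f x <= g x) ->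
    forall x, usc_regularization f x <= g x.
  by move=> ug fg x; apply: ereal_inf_lbound; exists g.
split=> // [x a|x].
  move=> /ereal_inf_lt[_ [g [ug fg] <-] /ug[V xV Va]]; exists V => // y /Va.
  by apply: le_lt_trans; exact: lb.
by apply: le_ereal_inf_tmp => _ [g [_ fg] <-].
Qed.

End Regularization.

(* Main.v *)
Require Import Defs.
From HB Require Import structures.
From mathcomp Require Import all_boot all_order all_algebra.
From mathcomp Require Import all_classical all_reals all_analysis.
From mathcomp Require Import ring lra.
Import Order.TTheory GRing.Theory Num.Theory.
Import numFieldNormedType.Exports.
Local Open Scope classical_set_scope.
Local Open Scope ring_scope.

(** After the change of variables [phi p], a set [Co p A] is an ordinary convex
    polytope, and a hyperplane [sum_i b_i z_i = g] becomes the hypersurface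
    [sum_i (a_i x_i)^(2p+1) = c^(2p+1)], whose coefficients [a_i], [c] are the
    odd roots of [b_i], [g].  The separating form is a limit, for p going to
    infinity, of such separating hypersurfaces.

    Let A and B be finite subsets of C and D.  All the sets [Co p A], [Co p B]
    lie in one ball, so if they met for every large p, their common points would
    accumulate at a point of [Co_infty A] and [Co_infty B], hence of C and D.
    Thus they are disjoint for arbitrarily large p ([Co_disjoint]), and the
    polytopes behind them are strictly separated by a hyperplane
    ([finite_hull_separation], from Gordan's alternative [gordan]).  By
    homogeneity the pair [(a, c)] can be put on the unit sphere
    ([phi_separation]).  The sphere is compact, so the separators obtained for
    growing A, B and p accumulate at some [(a, c)]
    ([exists_limit_separator]).

    It remains to pass to the limit.  An index i is dominant at x when
    [|a_i x_i|] is maximal.  A sum of high odd powers is governed by the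
    dominant terms, even if the terms themselves vary slightly with p: were
    [c < a_i x_i] for all dominant i, then [sum_i (a'_i x_i)^(2p+1)] would
    exceed [c'^(2p+1)] for all [(a', c')] near [(a, c)] and all large p
    ([near_sum_varphi_gt]).  Hence each x in C has a dominant i with
    [a_i x_i <= c] ([exists_dominant_le]).  On the other hand, stretching x
    slightly along a dominant coordinate i makes i strictly dominant, and there
    the form takes a value close to [a_i x_i]; so a lower semicontinuous
    minorant of the form is at most [a_i x_i] at x
    ([lsc_idempotent_form_le]).  The two facts together give the inequality on
    C, and the one on D follows by changing signs.  Finally [a] is nonzero,
    since [a = 0] would force [c = 0]. *)

(** * Odd powers *)

Section OddPowers.
Context {R : realType}.
Implicit Types (p : nat) (s t : R).

Lemma varphi0 p : varphi p 0 = 0 :> R.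
Proof. exact: expr0n. Qed.

Lemma varphiM p s t : varphi p (s * t) = varphi p s * varphi p t.
Proof. exact: exprMn. Qed.

Lemma varphi_ge0 p t : 0 <= t -> 0 <= varphi p t.
Proof. exact: exprn_ge0. Qed.

Lemma varphi_gt0 p t : 0 < t -> 0 < varphi p t.
Proof. exact: exprn_gt0. Qed.

Lemma ltr_varphi p : {mono varphi p : s t / s < t :> R}.
Proof.
apply: leW_mono; apply: le_mono => s t st; rewrite /varphi.
have [s0|s0] := leP 0 s; first by rewrite ltrXn2r.
have [t0|t0] := leP 0 t.
  apply: lt_le_trans (varphi_ge0 p t t0).
  by rewrite -[s]opprK -/(varphi p _) varphiN oppr_lt0 varphi_gt0// oppr_gt0.
rewrite -[s]opprK -[t]opprK -!/(varphi p _) !(varphiN p (- _)) ltrN2 /varphi.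
by rewrite ltrXn2r ?ltrN2// oppr_ge0 ltW.
Qed.

Lemma ler_varphi p : {mono varphi p : s t / s <= t :> R}.
Proof. by move=> s t; rewrite !leNgt ltr_varphi. Qed.

Lemma varphi_inv_lt p s t : (varphi_inv p s < t) = (s < varphi p t).
Proof. by rewrite -(ltr_varphi p) varphi_invK. Qed.

Lemma lt_varphi_inv p s t : (t < varphi_inv p s) = (varphi p t < s).
Proof. by rewrite -(ltr_varphi p) varphi_invK. Qed.

(** A fixed number of copies of the smaller base cannot compensate for a gap
    between the bases once the exponent is large. *)
Lemma near_varphi_gap (m d e : R) : 0 <= m -> 0 <= d -> d < e ->
  \forall p \near \oo, m * varphi p d < varphi p e.
Proof.
move=> m0 d0 de; have e0 := le_lt_trans d0 de.
have qd : `|d / e| < 1.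
  by rewrite ger0_norm ?divr_ge0 ?(ltW e0)// ltr_pdivrMr// mul1r.
have m1 : 0 < (m + 1)^-1 by rewrite invr_gt0 ltr_wpDl.
have /cvgrPdist_lt/(_ _ m1)[N _ NP] := cvg_expr qd.
exists N => // p /= Np.
have /NP/= : (N <= (2 * p).+1)%N.
  by rewrite (leq_trans Np)// ltnW// ltnS mul2n -addnn leq_addr.
rewrite sub0r normrN ger0_norm ?exprn_ge0 ?divr_ge0 ?(ltW e0)//.
rewrite expr_div_n ltr_pdivrMr ?exprn_gt0// mulrC ltr_pdivlMr ?ltr_wpDl//.
apply: le_lt_trans; rewrite mulrC ler_wpM2l ?exprn_ge0//.
by rewrite lerDl.
Qed.

End OddPowers.

(** * Sums of odd powers and their dominant terms *)

Section Dominant.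
Context {R : realType} {I : finType}.
Implicit Types (u : I -> R) (i : I).

(** The lower (upper) regularization of the form is the least (largest) [u i]
    over the dominant indices, where [u i = a_i x_i].  Bounds on it are
    expressed below by quantifying over these indices, so that neither value
    needs a formula of its own. *)
Definition dominant u i := forall j, `|u j| <= `|u i|.

Lemma exists_dominant u i : exists i, dominant u i.
Proof.
have [j _ uj] := arg_maxP (fun i => `|u i|) (erefl (xpredT i)).
by exists j => k; exact: uj.
Qed.

Lemma dominantN u i : dominant (fun j => - u j) i <-> dominant u i.
Proof. by split=> ui j; have := ui j; rewrite !normrN. Qed.

(** Two situations lead to the same estimate.  If some term is minus the
    maximal modulus, then [c] lies below all the terms, and the negative terms
    are beaten by [c] itself.  Otherwise the dominant terms all equal the
    maximal modulus, which exceeds both [c] and every [- u j].  In either case the gap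
    leaves room for two radii [d < e], and the strict inequalities persist under
    small perturbations of [u] and [c]. *)
Lemma below_dominant_gap u c i0 : (forall i, dominant u i -> c < u i) ->
  exists d e, [/\ 0 <= d, d < e, forall j, - d < u j &
    c < - e \/ c < d /\ exists i, e < u i].
Proof.
move=> cu; have [i ui] := exists_dominant u i0.
have cui := cu _ ui; set m := `|u i|.
have [[j uj]|uN] := pselect (exists j, u j = - m).
  have dj : dominant u j by move=> k; rewrite uj normrN normr_id; exact: ui.
  have := cu _ dj; rewrite uj => cm; have m0 : 0 <= m by exact: normr_ge0.
  exists (m + (- m - c) / 3), (m + (- m - c) / 2).
  split; [lra | lra | move=> k | left; lra].
  have := ui k; rewrite -/m ler_norml => /andP[+ _]; lra.
have uim : u i = m.
  rewrite /m; have [/ger0_norm->//|/ltr0_norm uiN] := leP 0 (u i).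
  by exfalso; apply: uN; exists i; rewrite /m uiN opprK.
have m0 : 0 < m.
  rewrite lt_neqAle normr_ge0 andbT eq_sym; apply/eqP => m0.
  by apply: uN; exists i; rewrite uim m0 oppr0.
(* r is still below m, and bounds c and the moduli of the negative terms *)
pose r := \big[Num.max/Num.max 0 c]_j (- u j).
have rm : r < m.
  apply/bigmax_ltP; rewrite gt_max m0 -uim cui; split=> // j _.
  rewrite uim lt_neqAle; apply/andP; split.
    by apply/eqP => ujm; apply: uN; exists j; rewrite -ujm opprK.
  by apply: le_trans (ui j); rewrite -normrN ler_norm.
have r0 : 0 <= r /\ c <= r.
  by apply/andP; rewrite -ge_max; exact: bigmax_ge_id.
exists ((2 * r + m) / 3), ((r + 2 * m) / 3).
split; [lra | lra | move=> j | right; split; [lra | exists i; lra]].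
have : - u j <= r by exact: le_bigmax.
lra.
Qed.

(** The terms are at least [- d], so all of them together lose at most
    [#|I| * d^(2p+1)]; this is negligible compared with [e^(2p+1)], which is
    supplied by [c < - e] or by a term larger than [e].  Letting terms and
    threshold vary along [F] independently of p is what allows passing to
    the limit in the separators. *)
Lemma near_sum_varphi_gt {T : Type} {F : set_system T} {FF : Filter F}
    (v : T -> I -> R) (k : T -> R) u c i0 :
  (forall i, v t i @[t --> F] --> u i) -> k t @[t --> F] --> c ->
  (forall i, dominant u i -> c < u i) ->
  \forall t \near F & p \near \oo, varphi p (k t) < \sum_i varphi p (v t i).
Proof.
move=> vu kc /(below_dominant_gap _ _ i0)[d [e [d0 de du cde]]].
have vd : \forall t \near F, forall j, - d < v t j.
  by apply: filter_forall => j; exact: cvgr_gt (vu j) _ (du j).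
have I0 : 0 <= #|I|%:R + 1 :> R by rewrite addr_ge0.
have gap := near_varphi_gap _ _ _ I0 d0 de.
have vs t p j : (- d < v t j) -> 0 <= varphi p (v t j) + varphi p d.
  by move=> /ltW; rewrite -(ler_varphi p) varphiN -subr_ge0 opprK.
(* shifted by the largest loss, all the terms are nonnegative *)
have sumE t p : \sum_j varphi p (v t j) =
    \sum_j (varphi p (v t j) + varphi p d) - #|I|%:R * varphi p d.
  by rewrite big_split/= sumr_const mulr_natl addrK.
case: cde => [ce|[cd [i ei]]].
  have ke : \forall t \near F, k t < - e by exact: cvgr_lt kc _ ce.
  near=> t p.
  have vdt : forall j, - d < v t j by near: t.
  have : varphi p (k t) < - varphi p e.
    by rewrite -varphiN ltr_varphi; near: t.
  have : (#|I|%:R + 1) * varphi p d < varphi p e by near: p.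
  have : 0 <= \sum_j (varphi p (v t j) + varphi p d).
    by apply: sumr_ge0 => j _; exact: vs.
  have := varphi_ge0 p _ d0; rewrite sumE mulrDl; lra.
have kd : \forall t \near F, k t < d by exact: cvgr_lt kc _ cd.
have ve : \forall t \near F, e < v t i by exact: cvgr_gt (vu i) _ ei.
near=> t p.
have vdt : forall j, - d < v t j by near: t.
have : varphi p (k t) < varphi p d by rewrite ltr_varphi; near: t.
have : (#|I|%:R + 1) * varphi p d < varphi p e by near: p.
have : varphi p e < varphi p (v t i) by rewrite ltr_varphi; near: t.
rewrite sumE (bigD1 i)//= => vei.
have : 0 <= \sum_(j | j != i) (varphi p (v t j) + varphi p d).
  by apply: sumr_ge0 => j _; exact: vs.
have := varphi_ge0 p _ d0; rewrite mulrDl; lra.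
Unshelve. all: by end_near. Qed.

(** The form in which [near_sum_varphi_gt] is used: an inequality that holds
    frequently along [F] and p survives in the limit for at least one dominant
    term. *)
Lemma exists_dominant_le {T : Type} {F : set_system T} {FF : Filter F}
    (v : T -> I -> R) (k : T -> R) u c i0 :
  (forall i, v t i @[t --> F] --> u i) -> k t @[t --> F] --> c ->
  (forall P N, F P -> exists t p, [/\ P t, (N <= p)%N &
    \sum_i varphi p (v t i) <= varphi p (k t)]) ->
  exists2 i, dominant u i & u i <= c.
Proof.
move=> vu kc le_vk; apply: contrapT => noi.
have [i ui|[P Q] [/= FP [N _ NQ]] PQ] := near_sum_varphi_gt v k u c i0 vu kc _.
  by rewrite ltNge; apply/negP => uic; apply: noi; exists i.
have [t [p [Pt Np]]] := le_vk P N FP.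
by rewrite leNgt (PQ (t, p) (conj Pt (NQ p Np))).
Qed.

(** The index [i] is the only dominant one, both for [u] and for [- u], so
    [near_sum_varphi_gt] bounds the root of the sum from both sides. *)
Lemma boxplus_dominant u i : (forall j, j != i -> `|u j| < `|u i|) ->
  boxplus u = u i.
Proof.
move=> ui; have uniq j : dominant u j -> j = i.
  by move=> /(_ i); apply: contraPeq => /ui; rewrite ltNge => /negP.
suff lo (w : I -> R) c : (forall j, dominant w j -> c < w j) ->
    \forall p \near \oo, varphi p c < \sum_j varphi p (w j).
  apply/cvg_lim => //; apply/cvgrPdist_lt => e e0.
  have lb := lo u (u i - e) (fun j uj => ltac:(by rewrite (uniq j uj); lra)).
  have := lo (fun j => - u j) (- (u i + e)).
  move=> /(_ (fun j => ltac:(move=> /dominantN/uniq ->; lra))) ub.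
  near=> p.
  have lp : u i - e < varphi_inv p (\sum_j varphi p (u j)).
    by rewrite lt_varphi_inv; near: p.
  have : varphi_inv p (\sum_j varphi p (u j)) < u i + e.
    rewrite varphi_inv_lt -ltrN2 -varphiN -sumrN.
    under eq_bigr do rewrite -varphiN.
    by near: p.
  by rewrite distrC ltr_norml; lra.
move=> cw; have [[P Q] [/= P0 Qoo] PQ] :=
  @near_sum_varphi_gt _ (nbhs (0 : R)) _ (fun=> w) (fun=> c) w c i
    (fun=> cvg_cst _) (cvg_cst _) cw.
apply: filterS Qoo => p Qp; apply: (PQ (0, p)); split=> //.
exact: nbhs_singleton P0.
Unshelve. all: by end_near. Qed.

End Dominant.

Lemma boxplus0 {R : realType} {I : finType} (u : I -> R) :
  (forall i, u i = 0) -> boxplus u = 0.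
Proof.
move=> u0; apply/cvg_lim => //.
rewrite (_ : (fun p => _) = cst 0); first exact: cvg_cst.
apply/funext => p; rewrite big1 => [|i _].
  by rewrite /varphi_inv sgr0 mul0r.
by rewrite u0 /varphi expr0n.
Qed.

(** * Regularizations of an idempotent form *)

Lemma lsc_limit_le {R : realType} {X : topologicalType} {T : Type}
    {F : set_system T} {FF : ProperFilter F} (g : X -> \bar R)
    (y : T -> X) (h : T -> R) x l :
  lower_semicontinuous g -> y t @[t --> F] --> x -> h t @[t --> F] --> l ->
  (\forall t \near F, (g (y t) <= (h t)%:E)%E) -> (g x <= l%:E)%E.
Proof.
move=> lg yx hl gh; rewrite leNgt; apply/negP => lgx.
have [c lc cgx] : exists2 c : R, l < c & (c%:E < g x)%E.
  case: (g x) lgx => [r| |]//=; rewrite ?lte_fin => lr.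
    by exists ((l + r) / 2); rewrite ?lte_fin midf_lt.
  by exists (l + 1); rewrite ?ltry// ltrDl.
have [V Vx Vg] := lg x c cgx.
have [t [[gt yt] ht]] :
    exists t, ((g (y t) <= (h t)%:E)%E /\ V (y t)) /\ h t < c.
  apply: (@filter_ex _ F); apply: filterI; first exact: filterI gh (yx _ Vx).
  exact: cvgr_lt hl _ lc.
have := lt_le_trans (Vg _ yt) gt; rewrite lte_fin => /lt_trans/(_ ht).
by rewrite ltxx.
Qed.

Lemma lower_semicontinuousN {R : realType} {X : topologicalType}
    (g : X -> \bar R) :
  upper_semicontinuous g -> lower_semicontinuous (fun x => - g x)%E.
Proof.
move=> ug x a; rewrite lteNr -EFinN => /ug[V Vx Vg]; exists V => // y /Vg.
by rewrite EFinN -lteNr.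
Qed.

Section Regularizations.
Context {R : realType} {n : nat}.
Implicit Types a x : 'rV[R]_n.

(** Stretching one coordinate breaks the ties between dominant indices. *)
Definition dilate x i (e : R) : 'rV[R]_n :=
  \row_j (if j == i then (1 + e) * x 0 j else x 0 j).

Lemma dilate_cvg x i : dilate x i e @[e --> 0^'+] --> x.
Proof.
have -> : dilate x i = fun e => x + e *: (x 0 i *: delta_mx 0 i).
  apply/funext => e; apply/rowP => j; rewrite !mxE eqxx/=.
  by case: eqVneq => [->|_]; rewrite ?mulr1 ?mulr0 ?addr0//; ring.
rewrite -[X in _ --> X]addr0; apply: cvgD; first exact: cvg_cst.
rewrite -[X in _ --> X](scale0r (x 0 i *: delta_mx 0 i)).
by apply: cvgZr_tmp; apply: cvg_within.
Qed.

(** The stretched coordinate is strictly dominant, so [boxplus] returns its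
    term, unless all the terms vanish. *)
Lemma idempotent_form_dilate a x i e : dominant (fun j => a 0 j * x 0 j) i ->
  0 < e -> idempotent_form a (dilate x i e) = (1 + e) * (a 0 i * x 0 i).
Proof.
move=> ui e0; rewrite /idempotent_form.
have [u0|u0] := eqVneq (a 0 i * x 0 i) 0.
  rewrite u0 mulr0 boxplus0// => j.
  have : a 0 j * x 0 j = 0.
    by apply/eqP; rewrite -normr_le0 (le_trans (ui j))// u0 normr0.
  by rewrite mxE; case: ifP => //_ uj; rewrite mulrCA uj mulr0.
rewrite (@boxplus_dominant _ _ _ i) => [|j ji]; rewrite !mxE eqxx.
  by rewrite mulrCA.
rewrite (negPf ji) (le_lt_trans (ui j))// mulrCA [ltRHS]normrM.
by rewrite ltr_pMl ?normr_gt0// gtr0_norm; lra.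
Qed.

Lemma stretched_term_cvg a x i :
  (1 + e) * (a 0 i * x 0 i) @[e --> (0 : R)^'+] --> a 0 i * x 0 i.
Proof.
rewrite -[X in _ --> X]mul1r; apply: cvgMr_tmp; rewrite -[X in _ --> X]addr0.
by apply: cvgD; [exact: cvg_cst|exact: cvg_within].
Qed.

(** The points [dilate x i e] tend to [x], and the values of the form there
    tend to [a_i x_i]: no lower semicontinuous minorant can exceed this limit
    at [x]. *)
Lemma lsc_idempotent_form_le a x i : dominant (fun j => a 0 j * x 0 j) i ->
  (lsc_regularization (fun z => (idempotent_form a z)%:E) x
     <= (a 0 i * x 0 i)%:E)%E.
Proof.
move=> ui; apply: ge_ereal_sup => _ [g [lg gf] <-].
apply: lsc_limit_le lg (dilate_cvg x i) (stretched_term_cvg a x i) _.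
near=> e; rewrite -idempotent_form_dilate//.
Unshelve. all: by end_near. Qed.

Lemma usc_idempotent_form_ge a x i : dominant (fun j => a 0 j * x 0 j) i ->
  ((a 0 i * x 0 i)%:E <=
     usc_regularization (fun z => (idempotent_form a z)%:E) x)%E.
Proof.
move=> ui; apply: le_ereal_inf_tmp => _ [g [ug fg] <-].
rewrite -leeN2 -EFinN.
apply: (lsc_limit_le _ _ _ _ _ (lower_semicontinuousN _ ug) (dilate_cvg x i)
  (cvgN (stretched_term_cvg a x i))).
near=> e; rewrite EFinN leeN2 -idempotent_form_dilate//.
Unshelve. all: by end_near. Qed.

End Regularizations.

(** * Separation of finitely generated convex sets *)

Section Separation.
Context {R : realType}.

Definition dot {n} (b x : 'rV[R]_n) : R := \sum_i b 0 i * x 0 i.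

Lemma dotDl {n} (b c x : 'rV[R]_n) : dot (b + c) x = dot b x + dot c x.
Proof. by rewrite -big_split; apply: eq_bigr => i _; rewrite mxE mulrDl. Qed.

Lemma dotZl {n} t (b x : 'rV[R]_n) : dot (t *: b) x = t * dot b x.
Proof. by rewrite mulr_sumr; apply: eq_bigr => i _; rewrite mxE mulrA. Qed.

Lemma dotC {n} (b x : 'rV[R]_n) : dot b x = dot x b.
Proof. by apply: eq_bigr => i _; rewrite mulrC. Qed.

Lemma dotDr {n} (b x y : 'rV[R]_n) : dot b (x + y) = dot b x + dot b y.
Proof. by rewrite !(dotC b) dotDl. Qed.

Lemma dotZr {n} t (b x : 'rV[R]_n) : dot b (t *: x) = t * dot b x.
Proof. by rewrite !(dotC b) dotZl. Qed.

Lemma dotxx_gt0 {n} (x : 'rV[R]_n) : x != 0 -> 0 < dot x x.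
Proof.
move=> /rV0Pn[i xi]; rewrite /dot (bigD1 i)//= ltr_wpDr//.
  by apply: sumr_ge0 => j _; rewrite -expr2 sqr_ge0.
by rewrite -expr2 exprn_even_gt0.
Qed.

(** Gordan's theorem of the alternative, by induction on the family.  Suppose
    that [b] is positive on the old vectors and nonpositive on the new vector
    [u].  Each old vector [v j] is moved along [u] into the hyperplane
    orthogonal to [b], up to a factor; this gives the family [v'].  A vanishing
    positive combination of [v'] is one of [v] and [u].  If instead [b'] is positive
    on [v'], then a combination [c] of [b] and [b'] is positive on the old vectors
    and vanishes on [u], and [c + e u] is positive everywhere for small [e].

    The indices are kept apart from the vectors because [v'] may identify
    distinct vectors. *)
Lemma gordan {n} {I : eqType} (r : seq I) (v : I -> 'rV[R]_n) : uniq r ->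
  (exists b, {in r, forall i, 0 < dot b (v i)}) \/
  (exists w : I -> R, [/\ {in r, forall i, 0 <= w i},
     exists2 i, i \in r & 0 < w i & \sum_(i <- r) w i *: v i = 0]).
Proof.
elim: r v => [|i r IH] v /=; first by move=> _; left; exists 0.
move=> /andP[ir ur]; set u := v i.
pose ext t (w : I -> R) j := if j == i then t else w j.
have ext_r t w : {in r, ext t w =1 w}.
  by move=> j jr; rewrite /ext; case: eqP => // ji; rewrite -ji jr in ir.
have exti t w : ext t w i = t by rewrite /ext eqxx.
have sum_ext t w : \sum_(j <- i :: r) ext t w j *: v j =
    t *: u + \sum_(j <- r) w j *: v j.
  by rewrite big_cons exti; congr +%R; apply: eq_big_seq => j jr; rewrite ext_r.
have ext_ge0 t w : 0 <= t -> {in r, forall j, 0 <= w j} ->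
    {in i :: r, forall j, 0 <= ext t w j}.
  by move=> t0 w0 j; rewrite inE => /predU1P[->|jr]; rewrite ?exti ?ext_r ?w0.
have ii : i \in i :: r by rewrite inE eqxx.
have ri j : j \in r -> j \in i :: r by rewrite inE orbC => ->.
have [u0|u0] := eqVneq u 0.
  right; exists (ext 1 (fun=> 0)); split; first exact: ext_ge0.
  - by exists i => //; rewrite exti.
  - by rewrite sum_ext u0 scaler0 add0r big1// => j _; rewrite scale0r.
have [[b br]|[w [w0 [j jr wj] wv]]] := IH v ur; last first.
  right; exists (ext 0 w); split; first exact: ext_ge0.
  - by exists j; rewrite ?ri// ext_r.
  - by rewrite sum_ext scale0r add0r.
have [bu|bu] := ltP 0 (dot b u).
  by left; exists b => j; rewrite inE => /predU1P[->//|/br].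
pose v' j := - dot b u *: v j + dot b (v j) *: u.
have [[b' b'r]|[w [w0 [j jr wj] wv]]] := IH v' ur.
  left; pose c := - dot b u *: b' + dot b' u *: b.
  have cv j : dot c (v j) = dot b' (v' j).
    by rewrite /c /v' dotDl !dotZl dotDr !dotZr; ring.
  have cu : dot c u = 0 by rewrite /c dotDl !dotZl; ring.
  have : \forall e \near 0^'+, forall k : 'I_(size r),
      0 < dot (c + e *: u) (v (tnth (in_tuple r) k)).
    apply: filter_forall => k; set j := tnth _ _.
    have cj : 0 < dot c (v j) by rewrite cv b'r// mem_tnth.
    have : dot c (v j) + e * dot u (v j) @[e --> 0^'+] --> dot c (v j).
      rewrite -[X in _ --> X]addr0; apply: cvgD; first exact: cvg_cst.
      rewrite -[X in _ --> X](mul0r (dot u (v j))).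
      by apply: cvgMr_tmp; exact: cvg_within.
    move=> /cvgr_gt/(_ _ cj); apply: filterS => e.
    by rewrite [dot (c + _) _]dotDl dotZl.
  move=> /(filterI (nbhs_right_gt 0))/filter_ex[e /= [e0 ce]].
  exists (c + e *: u) => j; rewrite inE => /predU1P[->|].
    by rewrite dotDl dotZl cu add0r mulr_gt0// dotxx_gt0.
  by move=> /(tnthP (in_tuple r))[k ->].
have wb0 k : k \in r -> 0 <= w k * dot b (v k).
  by move=> kr; rewrite mulr_ge0 ?w0 ?ltW ?br.
right.
exists (ext (\sum_(k <- r) w k * dot b (v k)) (fun k => - dot b u * w k)).
split.
- apply: ext_ge0; first by rewrite big_seq sumr_ge0.
  by move=> k kr; rewrite mulr_ge0 ?w0 ?oppr_ge0.
- exists i; rewrite // exti (big_rem j)//= ltr_wpDr//.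
    by rewrite big_seq sumr_ge0// => k /mem_rem; exact: wb0.
  by rewrite mulr_gt0 ?br.
- rewrite sum_ext -[RHS]wv scaler_suml -big_split; apply: eq_bigr => k _ /=.
  by rewrite /v' scalerDr !scalerA addrC [w k * - _]mulrC.
Qed.

Lemma convex_set_sum {n} {I : eqType} (K : set 'rV[R]_n) (r : seq I)
    (w : I -> R) (v : I -> 'rV[R]_n) :
  @convex_set R 'rV[R]_n K -> {in r, forall i, 0 <= w i} ->
  {in r, forall i, K (v i)} -> 0 < \sum_(i <- r) w i ->
  K ((\sum_(i <- r) w i)^-1 *: \sum_(i <- r) w i *: v i).
Proof.
move=> cK; elim: r => [|i r IH] w0 vK; rewrite ?big_nil ?ltxx// !big_cons.
have {}w0 : 0 <= w i /\ {in r, forall j, 0 <= w j}.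
  by split=> [|j jr]; apply: w0; rewrite inE ?eqxx ?jr ?orbT.
have {}vK : K (v i) /\ {in r, forall j, K (v j)}.
  by split=> [|j jr]; apply: vK; rewrite inE ?eqxx ?jr ?orbT.
case: w0 vK => wi0 w0 [vi vK].
set W := \sum_(j <- r) w j; have W0 : 0 <= W by rewrite /W big_seq sumr_ge0.
have [W_eq0|Wn0] := eqVneq W 0.
  have wr0 j : j \in r -> w j = 0.
    move=> jr; have /eqP := W_eq0; rewrite /W big_seq psumr_eq0//.
    by move=> /allP/(_ _ jr); rewrite jr => /eqP.
  rewrite /W [X in _ + X](_ : _ = 0) => [|].
    rewrite [X in _ *: (_ + X)](_ : _ = 0) => [|].
      by rewrite !addr0 => wi; rewrite scalerA mulVf ?scale1r ?gt_eqF.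
    by apply: big1_seq => j /= /wr0 ->; rewrite scale0r.
  by apply: big1_seq => j /= /wr0.
have {Wn0}W0 : 0 < W by rewrite lt_neqAle eq_sym Wn0.
move=> wW; have := IH w0 vK W0; rewrite -/W => {}IH.
have l0 : 0 <= w i / (w i + W) by rewrite divr_ge0// ltW.
have l1 : w i / (w i + W) <= 1 by rewrite ler_pdivrMr// mul1r lerDl ltW.
have := cK (v i) _ (Itv01 l0 l1) (mem_set vi) (mem_set IH).
move=> /set_mem; congr (K _); rewrite /conv/= scalerDr !scalerA /unstable.onem.
congr (_ *: _ + _ *: _); field; rewrite ?gt_eqF//.
Qed.

(** Gordan's alternative for the vectors [(- x, 1)] with [x] in [A] and
    [(y, - 1)] with [y] in [B].  A strictly positive functional on them is a
    strict separation.  In a vanishing combination the last coordinate shows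
    that [A] and [B] carry the same total weight, and the others that the two
    weighted means, which lie in the hulls, coincide. *)
Lemma finite_hull_separation {n} (A B : seq 'rV[R]_n) :
  convex_hull [set` A] `&` convex_hull [set` B] = set0 ->
  exists b c, {in A, forall x, dot b x < c} /\ {in B, forall y, c < dot b y}.
Proof.
move=> AB0.
pose r : seq ('rV[R]_n + 'rV[R]_n) := map inl (undup A) ++ map inr (undup B).
pose v (z : 'rV[R]_n + 'rV[R]_n) : 'rV[R]_(n + 1) :=
  match z with inl x => row_mx (- x) 1 | inr y => row_mx y (-1) end.
have ur : uniq r.
  rewrite cat_uniq !map_inj_uniq ?undup_uniq; try by move=> ? ? [].
  by rewrite /= andbT; apply/hasPn => z /mapP[y _ ->]; apply/mapP => -[].
have Ar x : x \in A -> inl x \in r.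
  by move=> xA; rewrite mem_cat map_f ?mem_undup.
have Br x : x \in B -> inr x \in r.
  by move=> xB; rewrite mem_cat orbC map_f ?mem_undup.
have dotE (b : 'rV[R]_(n + 1)) (x : 'rV[R]_n) t :
    dot b (row_mx x t) = dot (lsubmx b) x + b 0 (rshift n ord0) * t 0 0.
  rewrite /dot big_split_ord/= big_ord1 row_mxEr; congr (_ + _).
  by apply: eq_bigr => i _; rewrite row_mxEl mxE.
have [[b br]|[w [w0 [z zr wz] wv]]] := gordan r v ur.
  exists (lsubmx b), (b 0 (rshift n ord0)); split=> x.
    move=> /Ar/br; rewrite /v dotE mxE eqxx mulr1 -scaleN1r dotZr; lra.
  by move=> /Br/br; rewrite /v dotE !mxE eqxx mulrN mulr1; lra.
exfalso; move: wv; rewrite big_cat !big_map/=.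
set X := \sum_(x <- undup A) _; set Y := \sum_(y <- undup B) _ => XY0.
pose s := \sum_(x <- undup A) w (inl x).
pose t := \sum_(y <- undup B) w (inr y).
pose a := \sum_(x <- undup A) w (inl x) *: x.
pose b := \sum_(y <- undup B) w (inr y) *: y.
have rowE k : X 0 k + Y 0 k = 0.
  by have /rowP/(_ k) := XY0; rewrite !mxE.
have ab : a = b.
  apply/rowP => j; apply/esym/eqP; rewrite -subr_eq0 addrC; apply/eqP.
  rewrite -(rowE (lshift 1 j)) /X /Y /a /b !summxE -sumrN.
  by congr +%R; apply: eq_bigr => x _; rewrite [RHS]mxE row_mxEl !mxE ?mulrN.
have st : s = t.
  apply/eqP; rewrite -subr_eq0 -(rowE (rshift n ord0)) /X /Y !summxE -sumrN.
  apply/eqP; congr +%R; apply: eq_bigr => x _.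
    by rewrite mxE row_mxEr mxE eqxx mulr1.
  by rewrite mxE row_mxEr !mxE eqxx mulrN1.
have wA : {in undup A, forall x, 0 <= w (inl x)}.
  by move=> x; rewrite mem_undup => /Ar/w0.
have wB : {in undup B, forall y, 0 <= w (inr y)}.
  by move=> y; rewrite mem_undup => /Br/w0.
have s0 : 0 < s.
  have sge0 : 0 <= s by rewrite /s big_seq sumr_ge0.
  have tge0 : 0 <= t by rewrite /t big_seq sumr_ge0.
  suff : 0 < s + t by rewrite -st; lra.
  have -> : s + t = \sum_(z <- r) w z by rewrite big_cat !big_map.
  rewrite (big_rem z)//= ltr_wpDr// big_seq sumr_ge0// => k /mem_rem; exact: w0.
have cvx (E : set 'rV[R]_n) : @convex_set R 'rV[R]_n (convex_hull E).
  move=> x y l /set_mem xE /set_mem yE; apply/mem_set => K KE.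
  by have /set_mem := KE.1 x y l (mem_set (xE _ KE)) (mem_set (yE _ KE)).
have : (convex_hull [set` A] `&` convex_hull [set` B]) (s^-1 *: a).
  split.
    apply: (convex_set_sum _ _ _ _ (cvx _) wA) => // x.
    by rewrite mem_undup => xA; exact: sub_gen_smallest.
  rewrite st ab; apply: (convex_set_sum _ _ _ _ (cvx _) wB) => [y|].
    by rewrite mem_undup => yB; exact: sub_gen_smallest.
  by rewrite -/t -st.
by rewrite AB0.
Qed.

End Separation.

(** * Separating hypersurfaces for finite exponents *)

Section UpperLimits.
Context {R : realType} {n : nat}.
Implicit Types (A B : seq 'rV[R]_n) (x : 'rV[R]_n).

Lemma rV_norm_le x M : 0 <= M -> (`|x| <= M) <-> (forall i, `|x 0 i| <= M).
Proof.
move=> M0; rewrite -[`|x|]/(mx_norm x) mx_normrE; split=> [|xM].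
  by move=> /bigmax_leP[_ xM] i; exact: (xM (0, i)).
by apply/bigmax_leP; split=> // -[i j] _; rewrite ord1.
Qed.

Lemma compact_norm_le M : compact [set x : 'rV[R]_n | `|x| <= M].
Proof.
apply: bounded_closed_compact.
  by exists M; split=> [|t /ltW Mt x /= xM]; rewrite ?num_real// (le_trans xM).
apply: (@preimage_closed _ _ (fun x : 'rV[R]_n => `|x|) [set t | t <= M]).
  by move=> x _; exact: norm_continuous.
exact: closed_le.
Qed.

(** The indices are chosen one after the other, each beyond the previous one,
    since [Ls] asks for a strictly increasing sequence of exponents. *)
Lemma Ls_cluster (A_ : nat -> set 'rV[R]_n) x :
  (forall N e, 0 < e -> exists p y, [/\ (N <= p)%N, A_ p y & `|x - y| < e]) ->
  Ls A_ x.
Proof.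
move=> Ax.
have [h hP] : {h : nat * nat -> nat * 'rV[R]_n & forall Nj,
    [/\ (Nj.1 <= (h Nj).1)%N, A_ (h Nj).1 (h Nj).2 &
        `|x - (h Nj).2| < Nj.2.+1%:R^-1]}.
  apply: (@choice _ _ (fun Nj py => [/\ (Nj.1 <= py.1)%N, A_ py.1 py.2 &
        `|x - py.2| < Nj.2.+1%:R^-1])) => -[N j].
  by have [|p [y py]] := Ax N j.+1%:R^-1; [rewrite invr_gt0|exists (p, y)].
pose s := fix s j := if j is i.+1 then h ((s i).1.+1, j) else h (0, 0).
have sP j : A_ (s j).1 (s j).2 /\ `|x - (s j).2| < j.+1%:R^-1.
  by case: j => [|j]; [have [] := hP (0, 0)%N|have [] := hP ((s j).1.+1, j.+1)].
exists (fun j => (s j).1), (fun j => (s j).2); split.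
- apply/increasing_seqP => j; rewrite ltEnat/=.
  by have [] := hP ((s j).1.+1, j.+1).
- by move=> j; have [] := sP j.
- apply/cvgrPdist_lt => e e0; have := near_infty_natSinv_lt (PosNum e0).
  by apply: filterS => j /=; apply: lt_trans; have [] := sP j.
Qed.

(** A slab given by [|x_i| <= M] is the preimage under [phi p] of another slab,
    which is convex. *)
Lemma Co_bounded p (A : set 'rV[R]_n) M x : 0 <= M ->
  (forall y, A y -> `|y| <= M) -> Co p A x -> `|x| <= M.
Proof.
move=> M0 AM Ax; apply/rV_norm_le => // i.
have normv (t : R) : `|varphi p t| = varphi p `|t| by rewrite /varphi normrX.
rewrite -(ler_varphi p) -normv.
have : [set z : 'rV[R]_n | `|z 0 i| <= varphi p M] (phi p x).
  apply: Ax; split=> [y z l|_ [y Ay <-]]/=.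
    move=> /set_mem/= yM /set_mem/= zM; apply/mem_set => /=; rewrite !mxE.
    have l0 : 0 <= l%:num by [].
    have l1 : 0 <= 1 - l%:num by rewrite subr_ge0.
    rewrite (le_trans (ler_normD _ _))// !normrM (ger0_norm l0) (ger0_norm l1).
    by nra.
  by rewrite mxE normv ler_varphi; apply: (rV_norm_le _ _ M0).1; exact: AM.
by rewrite /= mxE.
Qed.

(** Common points of [Co p A] and [Co p B] for all large p stay in a ball,
    hence accumulate, and an accumulation point lies in both upper limits. *)
Lemma Co_disjoint A B :
  Co_infty [set` A] `&` Co_infty [set` B] = set0 ->
  forall N, exists2 p, (N <= p)%N & Co p [set` A] `&` Co p [set` B] = set0.
Proof.
move=> AB0 N; apply: contrapT => noN.
have meet p : exists x, (N <= p)%N -> (Co p [set` A] `&` Co p [set` B]) x.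
  have [Np|_] := leqP N p; last by exists 0.
  have [ABp|/set0P[x ABx]] := eqVneq (Co p [set` A] `&` Co p [set` B]) set0.
    by exfalso; apply: noN; exists p.
  by exists x.
have {meet}[x xP] := choice meet.
pose M := \big[Num.max/0]_(y <- A) `|y|.
have AM y : [set` A] y -> `|y| <= M by move=> yA; exact: le_bigmax_seq.
have M0 : 0 <= M by exact: bigmax_ge_id.
have [|l [_ lx]] := compact_norm_le M (x @ \oo) _.
  exists N => // p /= Np; apply: Co_bounded (xP p Np).1 => //.
suff : (Co_infty [set` A] `&` Co_infty [set` B]) l by rewrite AB0.
have near_l K e : 0 < e ->
    exists p, [/\ (N <= p)%N, (K <= p)%N & `|l - x p| < e].
  move=> e0; pose tail := [set p | (N <= p)%N && (K <= p)%N].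
  have [|_ [[p /= /andP[Np Kp] <-] xe]] :=
      lx (x @` tail) (ball l e) _ (nbhsx_ballx _ _ e0).
    by exists (maxn N K) => // p /=; rewrite geq_max => pNK; exists p.
  by exists p; split=> //; rewrite -ball_normE in xe.
by split; apply: Ls_cluster => K e /(near_l K)[p [Np Kp xe]];
  exists p, (x p); split=> //; have [] := xP p Np.
Qed.

(** The hypersurface that [phi p] maps onto a hyperplane weakly separating the
    images of [A] and [B].  Weak inequalities make the condition homogeneous in
    [(a, c)], which allows normalizing this pair. *)
Definition separates p A B (ac : 'rV[R]_n * R) :=
  {in A, forall x : 'rV[R]_n,
    \sum_i varphi p (ac.1 0 i * x 0 i) <= varphi p ac.2} /\
  {in B, forall y : 'rV[R]_n,
    varphi p ac.2 <= \sum_i varphi p (ac.1 0 i * y 0 i)}.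

(** The point of [A] rules out [(a, c) = 0], because the separation provided by
    [finite_hull_separation] is strict there. *)
Lemma phi_separation p A B x0 : x0 \in A ->
  Co p [set` A] `&` Co p [set` B] = set0 ->
  exists2 ac : 'rV[R]_n * R, `|ac| = 1 & separates p A B ac.
Proof.
move=> x0A AB0.
have imE (E : seq 'rV[R]_n) : phi p @` [set` E] = [set` map (phi p) E].
  apply/seteqP; split=> [_ [x xE <-]|_ /mapP[x xE ->]]; first exact: map_f.
  by exists x.
have [|b [g [bA bB]]] := finite_hull_separation (map (phi p) A) (map (phi p) B).
  rewrite -subset0 -!imE => z [zA zB].
  have zE : z = phi p (map_mx (varphi_inv p) z).
    by apply/rowP => i; rewrite !mxE varphi_invK.
  rewrite zE in zA zB.
  suff : (Co p [set` A] `&` Co p [set` B]) (map_mx (varphi_inv p) z).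
    by rewrite AB0.
  by split.
pose a := map_mx (varphi_inv p) b; pose c := varphi_inv p g.
have sumE (x : 'rV[R]_n) : \sum_i varphi p (a 0 i * x 0 i) = dot b (phi p x).
  by apply: eq_bigr => i _; rewrite varphiM !mxE varphi_invK.
have aA (x : 'rV[R]_n) : x \in A ->
    \sum_i varphi p (a 0 i * x 0 i) < varphi p c.
  by move=> xA; rewrite sumE varphi_invK bA// map_f.
have aB (y : 'rV[R]_n) : y \in B ->
    varphi p c < \sum_i varphi p (a 0 i * y 0 i).
  by move=> yB; rewrite sumE varphi_invK bB// map_f.
have t0 : 0 < `|(a, c)|.
  rewrite normr_gt0; apply/eqP => -[a0 c0].
  have := aA _ x0A; rewrite a0 c0 varphi0 big1 ?ltxx// => i _.
  by rewrite mxE mul0r varphi0.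
set t := `|(a, c)| in t0; have vt0 : 0 < varphi p t^-1.
  by rewrite varphi_gt0// invr_gt0.
have scale (x : 'rV[R]_n) : \sum_i varphi p ((t^-1 *: a) 0 i * x 0 i) =
    varphi p t^-1 * \sum_i varphi p (a 0 i * x 0 i).
  rewrite mulr_sumr; apply: eq_bigr => i _.
  by rewrite mxE -mulrA (varphiM p t^-1).
exists (t^-1 *: a, t^-1 * c); last split.
- have ti0 : 0 < t^-1 by rewrite invr_gt0.
  rewrite prod_normE/= normrZ normrM (gtr0_norm ti0) -maxr_pMr ?(ltW ti0)//.
  by rewrite -[Num.max _ _]/t mulVf// gt_eqF.
- by move=> x /aA/ltW; rewrite scale (varphiM p t^-1) ler_pM2l.
- by move=> x /aB/ltW; rewrite scale (varphiM p t^-1) ler_pM2l.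
Qed.

End UpperLimits.

(** * Accumulation of the separators *)

(** The sets of unit separators for finite [A], [B] and exponents beyond [N]
    shrink when [A], [B] or [N] grows, so they generate a proper filter on the
    unit sphere, which has a cluster point by compactness.  The constant is
    kept in the normalization together with the coefficients, which makes an
    a priori bound on it superfluous. *)
Lemma exists_limit_separator {R : realType} {n : nat} (C D : set 'rV[R]_n) :
  (forall (A B : seq 'rV[R]_n) N, [set` A] `<=` C -> [set` B] `<=` D ->
    exists2 ac : 'rV[R]_n * R, `|ac| = 1 &
      exists2 p, (N <= p)%N & separates p A B ac) ->
  exists2 ac0 : 'rV[R]_n * R, `|ac0| = 1 &
    forall (A B : seq 'rV[R]_n) (P : set ('rV[R]_n * R)) N,
      [set` A] `<=` C -> [set` B] `<=` D -> nbhs ac0 P ->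
      exists ac p, [/\ P ac, (N <= p)%N & separates p A B ac].
Proof.
move=> sepCD.
pose S (k : seq 'rV[R]_n * seq 'rV[R]_n * nat) : set ('rV[R]_n * R) :=
  [set ac | `|ac| = 1 /\ exists2 p, (k.2 <= p)%N & separates p k.1.1 k.1.2 ac].
pose K := [set k : seq 'rV[R]_n * seq 'rV[R]_n * nat |
  [set` k.1.1] `<=` C /\ [set` k.1.2] `<=` D].
have FF : ProperFilter (filter_from K S).
  apply: filter_from_proper; first apply: filter_from_filter.
  - by exists ([::], [::], 0)%N.
  - move=> [[A B] N] [[A' B'] N'] /= [/= AC BD] [/= AC' BD'].
    exists (A ++ A', B ++ B', maxn N N').
      split=> x /=; rewrite mem_cat => /orP[].
      + exact: AC.
      + exact: AC'.
      + exact: BD.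
      + exact: BD'.
    move=> ac [ac1 [p /= Np [Ap Bp]]].
    move: Np; rewrite geq_max => /andP[Np N'p].
    by split; split=> //; exists p => //=; split=> x xE;
      (apply: Ap || apply: Bp); rewrite mem_cat xE ?orbT.
  - by move=> [[A B] N] [/= AC BD]; have [ac] := sepCD A B N AC BD; exists ac.
have cB : compact ([set a : 'rV[R]_n | `|a| <= 1] `*` [set c : R | `|c| <= 1]).
  apply: compact_setX; first exact: compact_norm_le.
  have -> : [set c : R | `|c| <= 1] = `[-1, 1]%classic.
    by apply/seteqP; split=> t /=; rewrite in_itv/= ler_norml.
  exact: segment_compact.
have F1 : filter_from K S [set ac | `|ac| = 1].
  by exists ([::], [::], 0)%N => // ac [].
have [|ac0 [_ acS]] := cB _ FF _.
  apply: filterS F1 => -[a c] /= <-.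
  by split; rewrite /= prod_normE/= le_max lexx ?orbT.
exists ac0.
  have closed1 : closed [set ac : 'rV[R]_n * R | `|ac| = 1].
    apply: (@preimage_closed _ _ (fun ac : 'rV[R]_n * R => `|ac|) [set 1]).
      by move=> ac _; exact: norm_continuous.
    exact: closed_eq.
  by apply: closed1; move: acS; rewrite clusterE => /(_ _ F1).
move=> A B P N AC BD Pac.
have [|ac [[_ [p Np sep]] Pc]] := acS (S (A, B, N)) P _ Pac.
  by exists (A, B, N).
by exists ac, p.
Qed.

(** * The separation theorem *)

Theorem proposition4p2p4 (R : realType) (n : nat) (C D : set 'rV[R]_n)
    (C_neq0 : C !=set0) (D_neq0 : D !=set0)
    (C_closed : closed C) (D_closed : closed D)
    (C_Bconvex : Bconvex C) (D_Bconvex : Bconvex D)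
    (CD0 : C `&` D = set0) :
  exists (a : 'rV[R]_n) (c : R),
    [/\ a != 0,
        C `<=` [set x | (lsc_regularization
                           (fun z => (idempotent_form a z)%:E) x <= c%:E)%E] &
        D `<=` [set x | (c%:E <= usc_regularization
                           (fun z => (idempotent_form a z)%:E) x)%E]].
Proof.
have [x0 Cx0] := C_neq0; have [y0 Dy0] := D_neq0.
(* for n = 0 there is only one point, so that C and D cannot be disjoint *)
have [[i0 _]|I0] := pselect (exists i : 'I_n, True); last first.
  suff : (C `&` D) x0 by rewrite CD0.
  split=> //; suff -> : x0 = y0 by [].
  by apply/rowP => i; exfalso; apply: I0; exists i.
have [[a c] ac1 acP] : exists2 ac0 : 'rV[R]_n * R, `|ac0| = 1 &
    forall (A B : seq 'rV[R]_n) (P : set ('rV[R]_n * R)) N,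
      [set` A] `<=` C -> [set` B] `<=` D -> nbhs ac0 P ->
      exists ac p, [/\ P ac, (N <= p)%N & separates p A B ac].
  apply: exists_limit_separator => A B N AC BD.
  (* adding x0 to A ensures that phi_separation applies *)
  have x0AC : [set` x0 :: A] `<=` C.
    by move=> x /=; rewrite inE => /predU1P[->//|]; exact: AC.
  have [|p Np ABp] := @Co_disjoint _ _ (x0 :: A) B _ N.
    rewrite -subset0 -CD0; apply: setISS.
      by apply: C_Bconvex => //; exact: finite_seq.
    by apply: D_Bconvex => //; exact: finite_seq.
  have [ac ac1 [Ap Bp]] := phi_separation p (x0 :: A) B x0 (mem_head _ _) ABp.
  exists ac => //; exists p => //; split=> // x xA.
  by apply: Ap; rewrite inE xA orbT.
have coordE (x : 'rV[R]_n) j :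
    (fun ac : 'rV[R]_n * R => ac.1 0 j * x 0 j) @ (a, c) --> a 0 j * x 0 j.
  apply: cvgMr_tmp.
  apply: (@cvg_comp _ _ _ fst (fun b : 'rV[R]_n => b 0 j) _ (nbhs a)).
    exact: cvg_fst.
  exact: coord_continuous.
have nil_sub (E : set 'rV[R]_n) : [set` [::]] `<=` E by [].
have sub1 (E : set 'rV[R]_n) x : E x -> [set` [:: x]] `<=` E.
  by move=> Ex z /=; rewrite inE => /eqP ->.
have aC x : C x -> exists2 i, dominant (fun j => a 0 j * x 0 j) i &
    a 0 i * x 0 i <= c.
  move=> Cx; apply: (exists_dominant_le (fun ac : 'rV[R]_n * R => _) _ _ _ i0
    (coordE x) cvg_snd) => P N.
  move=> /(acP [:: x] [::] P N (sub1 _ _ Cx) (nil_sub _)).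
  move=> [ac [p [Pac Np [xp _]]]].
  by exists ac, p; split=> //; apply: xp; rewrite mem_head.
have aD y : D y -> exists2 i, dominant (fun j => a 0 j * y 0 j) i &
    c <= a 0 i * y 0 i.
  move=> Dy; have [|i /dominantN ui] := exists_dominant_le
    (fun (ac : 'rV[R]_n * R) j => - (ac.1 0 j * y 0 j)) (fun ac => - ac.2)
    (fun j => - (a 0 j * y 0 j)) (- c) i0
    (fun j => cvgN (coordE y j)) (cvgN cvg_snd).
  - move=> P N.
    move=> /(acP [::] [:: y] P N (nil_sub _) (sub1 _ _ Dy)).
    move=> [ac [p [Pac Np [_ yp]]]].
    exists ac, p; split=> //; rewrite varphiN -lerN2 opprK -sumrN.
    under eq_bigr do rewrite varphiN opprK.
    by apply: yp; rewrite mem_head.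
  - by rewrite lerN2 => cu; exists i.
exists a, c; split.
- apply/eqP => a0.
  have [i _] := aC _ Cx0; have [j _] := aD _ Dy0.
  rewrite a0 !mxE !mul0r => c_le0 c_ge0.
  have c0 : c = 0 by apply/eqP; rewrite eq_le c_le0.
  by move: ac1; rewrite a0 c0 normr0 => /esym/eqP; rewrite oner_eq0.
- move=> x /aC[i ui uc]; apply: le_trans (lsc_idempotent_form_le _ _ _ ui) _.
  by rewrite lee_fin.
- move=> y /aD[i ui cu]; apply: le_trans (usc_idempotent_form_ge _ _ _ ui).
  by rewrite lee_fin.
Qed.
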